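(* Let $\mathcal{S}$ be a Polish space and $K\subset\mathcal{S}$ measurable. Let $Y$ be a time-homogeneous Markov chain on $\mathcal{S}$, let $Z$ be a possibly time-inhomogeneous Markov chain on $\mathcal{S}$, and let $X$ be a stochastic process that is $(Y,Z)$-hybrid with respect to $K$. Suppose there are a nonnegative measurable function $\varphi:\mathbb{N}_0\times\mathcal{S}\to[0,\infty[$, a nonnegative measurable function $V:\mathcal{S}\to\mathbb{R}$, and a positive sequence $(\theta(t))_{t\in\mathbb{N}_0}$ such that: (i) for every $z_0\in\mathcal{S}\setminus K$, when $Z_0=z_0$ and $\tau_K:=\inf\{t>0: Z_t\in K\}$, the process $\bigl(\varphi(t\wedge\tau_K,Z_{t\wedge\tau_K})\bigr)_{t\in\mathbb{N}_0}$ is a supermartingale; (ii) $\varphi(t,x)\ge V(x)/\theta(t)$ for all $(t,x)\in\mathbb{N}_0\times\mathcal{S}$, and $C:=\sum_{t\in\mathbb{N}_0}\theta(t)<\infty$; (iii) $\delta:=\sup_{x\in K}V(x)<\infty$. Suppose also that $$\beta:=\sup_{y_0\in K}\mathsf{E}\bigl[\varphi(0,Y_1)\mathbf{1}_{\{Y_1\in\mathcal{S}\setminus K\}}\,\big|\,Y_0=y_0\bigr]<\infty,$$ and let $\gamma:=\sup_{t\in\mathbb{N}_0}\theta(t)$. If $X$ starts from $x_0\in\mathcal{S}\setminus K$, then $$\sup_{t\in\mathbb{N}_0}\mathsf{E}_{x_0}\bigl[V(X_t)\bigr]\le C\beta+\delta+\gamma\,\varphi(0,x_0).$$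
   Context: $\mathbb{N}_0=\{0,1,2,\ldots\}$; supermartingales are with respect to the natural filtration; $\inf\emptyset=+\infty$. $(Y,Z)$-hybrid process with respect to $K$: a process $X=(X_t)_{t\in\mathbb{N}_0}$ with values in $\mathcal{S}$ and natural filtration $(\mathcal{F}_t)$ such that, for every measurable $B\subset\mathcal{S}$ and every $t$: - if $X_t=x\in K$, then $\mathsf{P}(X_{t+1}\in B\mid\mathcal{F}_t)=\mathsf{P}(Y_1\in B\mid Y_0=x)$; - if $X_t=x\notin K$, then $\mathsf{P}(X_{t+1}\in B\mid\mathcal{F}_t)=\mathsf{P}(Z_{t+1-\sigma}\in B\mid Z_{t-\sigma}=x)$, where $\sigma\le t$ is the starting time of the current excursion outside $K$, i.e. the smallest $s\le t$ such that $X_s,X_{s+1},\dots,X_t\notin K$. (Thus $X$ moves like $Y$ inside $K$; each time it exits $K$ it moves, until it re-enters $K$, like a fresh copy of $Z$ whose clock is restarted at $0$ at the exit time. If $X_0\notin K$, the initial excursion starts at time $0$.) The conditional probabilities on the right denote the one-step transition kernels of $Y$ and $Z$. *)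

(* Defs.v *)
From mathcomp Require Import all_boot all_order all_algebra.
From mathcomp Require Import all_classical all_reals all_analysis.
From mathcomp Require Import measurable_realfun.

Set Implicit Arguments.
Unset Strict Implicit.
Unset Printing Implicit Defensive.

Import Order.TTheory GRing.Theory Num.Theory.
Import numFieldNormedType.Exports.

Local Open Scope classical_set_scope.
Local Open Scope ring_scope.

(* Separable, and the topology is induced by some complete metric. *)
Definition polish_space (R : realType) (T : topologicalType) : Prop :=
  (exists2 D : set T, countable D & dense D) /\
  exists dist : T -> T -> R,
    [/\ (forall x y, 0 <= dist x y) /\ (forall x y, dist x y = 0 <-> x = y),
        forall x y, dist x y = dist y x,
        forall x y z, dist x z <= dist x y + dist y z,
        forall (x : T) (A : set T),
          nbhs x A <-> exists2 e : R, 0 < e & [set y | dist x y < e] `<=` A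
      & forall u : nat -> T,
          (forall e : R, 0 < e -> exists N : nat, forall m n : nat,
             (N <= m)%N -> (N <= n)%N -> dist (u m) (u n) < e) ->
          exists l : T, u @ \oo --> l].

Notation borel T := (g_sigma_algebraType (@open T)).

(* Supremum in [0, +oo]: for nonnegative families it is the usual supremum,
   and the empty family has supremum 0 (whereas ereal_sup set0 = -oo). *)
Definition nneg_sup (R : realType) (A : set (\bar R)) : \bar R :=
  ereal_sup ([set 0%E] `|` A).

Section processes.
Context {d dS : measure_display} {Omega : measurableType d}
  {S : measurableType dS} {R : realType}.
Implicit Types (P : probability Omega R) (G : set (set Omega)).

Definition natural_filtration (X : nat -> Omega -> S) (t : nat) :
    set (set Omega) :=
  <<s \bigcup_(s in [set s | (s <= t)%N]) g_sigma_algebra_preimage (X s) >>.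

(* g is a version of E[f | G] (under P); G is meant to be a sub-sigma-algebra
   and f to be integrable. *)
Definition is_cond_exp P G (f g : Omega -> \bar R) : Prop :=
  [/\ P.-integrable setT g,
      forall B : set (\bar R), measurable B -> G (g @^-1` B)
    & forall A, G A -> (\int[P]_(w in A) g w = \int[P]_(w in A) f w)%E].

Definition is_cond_prob P G (A : set Omega) (g : Omega -> \bar R) : Prop :=
  is_cond_exp P G (EFin \o \1_A) g.

Definition supermartingale P (F : nat -> set (set Omega))
    (M : nat -> Omega -> R) : Prop :=
  forall t : nat,
    [/\ forall B : set R, measurable B -> F t (M t @^-1` B),
        P.-integrable setT (EFin \o M t)
      & exists2 g : Omega -> \bar R,
          is_cond_exp P (F t) (EFin \o M t.+1) g
        & {ae P, forall w, (g w <= (M t w)%:E)%E}].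

(* A Markov chain is given together with its laws from all starting points:
   under P z the process Z starts at z, and k t is its transition kernel from
   time t to time t + 1. *)
Definition markov_chain (k : nat -> R.-pker S ~> S)
    (P : S -> probability Omega R) (Z : nat -> {mfun Omega >-> S}) : Prop :=
  forall z : S,
    {ae P z, forall w, Z 0%N w = z} /\
    forall (t : nat) (B : set S), measurable B ->
      is_cond_prob (P z) (natural_filtration Z t) (Z t.+1 @^-1` B)
        (fun w => k t (Z t w) B).

(* The smallest s <= t such that the path x is outside K at the times
   s, ..., t; only meaningful when x t is not in K. *)
Definition excursion_start (K : set S) (x : nat -> S) (t : nat) : nat :=
  find (fun s => `[< forall r : nat, (s <= r <= t)%N -> ~ K (x r) >])
       (iota 0 t.+1).

(* kY is the time-homogeneous kernel of Y and kZ u the kernel of Z from time u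
   to time u + 1. *)
Definition hybrid_transition (K : set S) (kY : R.-pker S ~> S)
    (kZ : nat -> R.-pker S ~> S) (x : nat -> S) (t : nat) (B : set S) :
    \bar R :=
  if x t \in K then kY (x t) B
  else kZ (t - excursion_start K x t)%N (x t) B.

Definition hybrid_process (K : set S) (kY : R.-pker S ~> S)
    (kZ : nat -> R.-pker S ~> S) P (X : nat -> {mfun Omega >-> S}) : Prop :=
  forall (t : nat) (B : set S), measurable B ->
    is_cond_prob P (natural_filtration X t) (X t.+1 @^-1` B)
      (fun w => hybrid_transition K kY kZ (fun s => X s w) t B).

End processes.

(* inf {t > 0 | x t in K}, where None stands for +oo. *)
Definition hitting_time (S : Type) (K : set S) (x : nat -> S) : option nat :=
  if pselect (exists t : nat, (0 < t)%N && (x t \in K)) is left ex_t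
  then Some (ex_minn ex_t) else None.

Definition min_time (t : nat) (tau : option nat) : nat :=
  if tau is Some s then minn t s else t.

Definition stopped_value (S : Type) (R : realType) (K : set S)
    (phi : nat * S -> R) (x : nat -> S) (t : nat) : R :=
  let s := min_time t (hitting_time K x) in phi (s, x s).

(* Main.v *)
(* Decompose E[V(X_t)] according to the last time r < t at which X visits K.
   If X_t is in K, the contribution is at most delta. If the excursion in
   progress at time t started at time m, then V(X_t) <= theta(t - m) *
   phi(t - m, X_t), and during the excursion X moves like a fresh copy of Z, so
   by the supermartingale property the expectation of phi(t - m, X_t) on this
   event is at most that of phi(0, X_m). The latter is phi(0, x0) for m = 0,
   and at most beta for m > 0, because X then enters its excursion with a step
   of Y from a point of K. Summing theta(t - m) over m gives the bound. *)

Require Import Defs.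
From mathcomp Require Import all_boot all_order all_algebra.
From mathcomp Require Import all_classical all_reals all_analysis.
From mathcomp Require Import measurable_realfun.

Set Implicit Arguments.
Unset Strict Implicit.
Unset Printing Implicit Defensive.

Import Order.TTheory GRing.Theory Num.Theory.
Import numFieldNormedType.Exports.

Local Open Scope classical_set_scope.
Local Open Scope ring_scope.

(** * Integrating a function of the next state against a transition kernel *)

Section integral_transition.
Context {d dT : measure_display} {Omega : measurableType d}
  {T : measurableType dT} {R : realType}.
Variables (mu : {measure set Omega -> \bar R}) (A : set Omega)
  (W : Omega -> T) (k : Omega -> {measure set T -> \bar R}).
Hypotheses (mA : measurable A) (mW : measurable_fun setT W).
Hypothesis mk : forall B, measurable B -> measurable_fun setT (k ^~ B).
Hypothesis muk : forall B, measurable B ->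
  mu (A `&` W @^-1` B) = (\int[mu]_(w in A) k w B)%E.

Import HBNNSimple.

Let integral_transition_nnsfun (f : {nnsfun T >-> R}) :
  (\int[mu]_(w in A) (f (W w))%:E =
   \int[mu]_(w in A) \int[k w]_y (f y)%:E)%E.
Proof.
have mfW r : measurable (W @^-1` (f @^-1` [set r])).
  by rewrite -[X in measurable X]setTI; exact: mW.
have f0 r : (r < 0)%R -> f @^-1` [set r] = set0 by exact: preimage_nnfun0.
under [LHS]eq_integral do rewrite fimfunE -fsumEFin//.
rewrite ge0_integral_fsum//; last 2 first.
  - move=> r; apply/measurable_EFinP/measurable_funM => //.
    exact: (@measurable_indic _ _ _ _ (W @^-1` (f @^-1` [set r]))).
  - by move=> r w _; rewrite EFinM nnfun_muleindic_ge0.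
under [RHS]eq_integral => w _.
  under eq_integral do rewrite fimfunE -fsumEFin//.
  rewrite ge0_integral_fsum//; last 2 first.
    - by move=> r; exact/measurable_EFinP/measurableT_comp.
    - by move=> r y _; rewrite EFinM nnfun_muleindic_ge0.
  under eq_fsbigr => r _.
    rewrite (integralZl_indic _ (fun r => f @^-1` [set r]))//; last exact: f0.
    rewrite integral_indic// setIT.
    over.
  over.
rewrite /= ge0_integral_fsum//; last 2 first.
  - move=> r; apply: measurable_funeM.
    by apply: (measurable_funS measurableT) => //; exact: mk.
  - move=> r w _; have := mulemu_ge0 (fun r => f @^-1` [set r]).
    by apply; exact: f0.
apply: eq_fsbigr => r _.
rewrite (integralZl_indic _ (fun r => W @^-1` (f @^-1` [set r])))//; last first.
  by move=> /f0 ->; rewrite preimage_set0.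
rewrite integral_indic// setIC muk//.
(* Membership of [r] in the range of [f] was dropped, so negative [r] also occur; for them the fibre
   is empty and both sides vanish. *)
have [r0|r0] := leP 0%R r.
  rewrite ge0_integralZl//.
  by apply: (measurable_funS measurableT) => //; exact: mk.
rewrite integral0_eq; last by move=> w _; rewrite f0.
by rewrite mule0 integral0_eq// => w _; rewrite f0// measure0 mule0.
Qed.

(** [muk] is the case of indicators; linearity gives simple functions and monotone convergence the
    rest. Since [A] is fixed, [k] has to be the correct transition only on that event, as with [kY]
    on visits of [X] to [K]. *)
Lemma integral_transition (f : T -> \bar R) :
  (forall y, (0 <= f y)%E) -> measurable_fun setT f ->
  (\int[mu]_(w in A) f (W w) = \int[mu]_(w in A) \int[k w]_y f y)%E.
Proof.
move=> f0 mf; pose f_ := nnsfun_approx measurableT mf.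
have f_cvg y : (f_ n y)%:E @[n --> \oo] --> f y by exact: cvg_nnsfun_approx.
have f_nd y : {homo (fun n => (f_ n y)%:E) : m n / (m <= n)%N >-> (m <= n)%E}.
  by move=> m n mn; rewrite lee_fin; exact/lefP/nd_nnsfun_approx.
have mf_ n : measurable_fun setT (EFin \o f_ n) by exact/measurable_EFinP.
transitivity (\int[mu]_(w in A) lim ((f_ n (W w))%:E @[n --> \oo]))%E.
  by apply: eq_integral => w _; apply/esym/cvg_lim => //; exact: f_cvg.
rewrite monotone_convergence//; last 2 first.
- move=> n; apply: (measurable_funS measurableT) => //.
  exact: (measurableT_comp (mf_ n)).
- by move=> n w _; rewrite lee_fin.
rewrite [X in limn X](_ : _ =
    fun n => \int[mu]_(w in A) \int[k w]_y (f_ n y)%:E)%E; last first.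
  by apply/funext => n; exact: integral_transition_nnsfun.
rewrite -monotone_convergence//; last 3 first.
- move=> n; apply: (measurable_funS measurableT) => //.
  by apply: (measurable_fun_integral_kernel mk _ (mf_ n)) => y; rewrite lee_fin.
- by move=> n w _; apply: integral_ge0 => y _; rewrite lee_fin.
- move=> w _ m n mn; apply: ge0_le_integral => //.
  + by move=> y _; rewrite lee_fin.
  + exact: mf_.
  + exact: mf_.
  + by move=> y _; exact: f_nd.
apply: eq_integral => w _; rewrite -monotone_convergence//.
- by apply: eq_integral => y _; apply/cvg_lim => //; exact: f_cvg.
- by move=> n y _; rewrite lee_fin.
Qed.

Lemma integral_transition_in (D : set T) (f : T -> \bar R) :
  measurable D -> (forall y, (0 <= f y)%E) -> measurable_fun setT f ->
  (\int[mu]_(w in A `&` W @^-1` D) f (W w) =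
   \int[mu]_(w in A) \int[k w]_(y in D) f y)%E.
Proof.
move=> mD f0 mf; rewrite integral_mkcondr.
under [RHS]eq_integral do rewrite integral_mkcond.
rewrite -integral_transition; first by [].
- by move=> y; rewrite patchE; case: ifP.
- by apply/(measurable_restrictT _ mD); exact: (measurable_funS measurableT).
Qed.

End integral_transition.

(** * Events on which a path avoids [K] during a time window *)

Definition away {U T : Type} (K : set T) (W : nat -> U -> T) (m n : nat) :
    set U :=
  [set w | forall i, (m <= i <= n)%N -> ~ K (W i w)].

Lemma away_bigcap {U T : Type} (K : set T) (W : nat -> U -> T) m n :
  away K W m n = \bigcap_(i in [set i | (m <= i <= n)%N]) W i @^-1` (~` K).
Proof. by []. Qed.

Lemma awaynn {U T : Type} (K : set T) (W : nat -> U -> T) n :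
  away K W n n = W n @^-1` (~` K).
Proof.
apply/seteqP; split=> w /= h; first by apply: h; rewrite leqnn.
by move=> i; rewrite -eqn_leq => /eqP <-.
Qed.

Lemma awayS {U T : Type} (K : set T) (W : nat -> U -> T) m n :
  (m <= n.+1)%N -> away K W m n.+1 = away K W m n `&` W n.+1 @^-1` (~` K).
Proof.
move=> mn; apply/seteqP; split=> [w h|w [h hn] i].
- split=> [i /andP[mi ni]|]; first by apply: h; rewrite mi leqW.
  by apply: h; rewrite mn leqnn.
- move=> /andP[mi]; rewrite leq_eqVlt ltnS => /orP[/eqP -> //|ni].
  by apply: h; rewrite mi.
Qed.

Lemma away_split {U T : Type} (K : set T) (W : nat -> U -> T) m n :
  (m <= n)%N -> away K W m n = W m @^-1` (~` K) `&` away K W m.+1 n.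
Proof.
move=> mn; apply/seteqP; split=> [w h|w [hm h] i].
- split=> [|i /andP[mi ni]]; first by apply: h; rewrite leqnn.
  by apply: h; rewrite ltnW.
- move=> /andP[+ ni]; rewrite leq_eqVlt => /orP[/eqP <- //|mi].
  by apply: h; rewrite mi.
Qed.

(** * Measurability with respect to the natural filtration *)

Lemma measurable_preimage {d dT : measure_display} {Omega : measurableType d}
  {T : measurableType dT} (W : {mfun Omega >-> T}) (B : set T) :
  measurable B -> measurable (W @^-1` B).
Proof.
by move=> mB; rewrite -[X in measurable X]setTI; exact: measurable_funP.
Qed.

Section filtration.
Context {d dT : measure_display} {Omega : measurableType d}
  {T : measurableType dT} {R : realType}.
Implicit Types (W : nat -> {mfun Omega >-> T}) (K : set T).

Lemma natural_filtration_sub W t A : natural_filtration W t A -> measurable A.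
Proof.
apply: smallest_sub => [|B [s _] [C mC <-]].
  exact: sigma_algebra_measurable.
by rewrite setTI; exact: measurable_preimage.
Qed.

Lemma natural_filtration_preimage (W : nat -> Omega -> T) s t B :
  (s <= t)%N -> measurable B -> natural_filtration W t (W s @^-1` B).
Proof.
move=> st mB; apply: sub_gen_smallest; exists s => //.
by exists B => //; rewrite setTI.
Qed.

Lemma natural_filtrationT (W : nat -> Omega -> T) t :
  natural_filtration W t setT.
Proof. exact: (@measurableT _ (g_sigma_algebraType _)). Qed.

Lemma natural_filtrationI (W : nat -> Omega -> T) t A B :
  natural_filtration W t A -> natural_filtration W t B ->
  natural_filtration W t (A `&` B).
Proof. exact: (@measurableI _ (g_sigma_algebraType _)). Qed.

Lemma natural_filtration_away (W : nat -> Omega -> T) K m n t :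
  measurable K -> (n <= t)%N -> natural_filtration W t (away K W m n).
Proof.
move=> mK nt; rewrite away_bigcap.
apply: (@bigcap_measurableType _ (g_sigma_algebraType _)) => i /andP[_ ni].
by apply: natural_filtration_preimage; [exact: leq_trans nt|exact: measurableC].
Qed.

Lemma measurable_away W K m n : measurable K -> measurable (away K W m n).
Proof.
by move=> mK; apply: natural_filtration_sub; exact: natural_filtration_away.
Qed.

(** Brings a conditional probability into the form of [muk]: an identity on one event of the
    past. *)
Lemma cond_prob_integral (P : probability Omega R) W t E g A :
  measurable E -> is_cond_prob P (natural_filtration W t) E g ->
  natural_filtration W t A -> P (A `&` E) = (\int[P]_(w in A) g w)%E.
Proof.
move=> mE [_ _ Pg] FA; have mA := natural_filtration_sub FA.
by rewrite Pg// integral_indic// setIC.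
Qed.

End filtration.

(** * Transition operators killed on entering [K], and excursions *)

Section killed.
Context {d dT : measure_display} {Omega : measurableType d}
  {T : measurableType dT} {R : realType}.
Variables (K : set T) (k : nat -> R.-pker T ~> T).
Hypothesis mK : measurable K.

(* killed n f x is the expectation of f (Z n) on the event that Z 1, ..., Z n
   avoid K, for the chain Z with kernels k started at x. *)
Fixpoint killed (n : nat) (f : T -> \bar R) : T -> \bar R :=
  if n is n'.+1 then killed n' (fun x => \int[k n' x]_(y in ~` K) f y)%E else f.

Lemma killed_step_ge0 n (f : T -> \bar R) : (forall x, (0 <= f x)%E) ->
  forall x, (0 <= \int[k n x]_(y in ~` K) f y)%E.
Proof. by move=> f0 x; exact: integral_ge0. Qed.

Lemma measurable_killed_step n (f : T -> \bar R) :
  (forall x, (0 <= f x)%E) -> measurable_fun setT f ->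
  measurable_fun setT (fun x => \int[k n x]_(y in ~` K) f y)%E.
Proof.
move=> f0 mf; under eq_fun do rewrite integral_mkcond.
apply: measurable_fun_integral_kernel.
- by move=> B mB; exact: measurable_kernel.
- by move=> y; rewrite patchE; case: ifP.
- apply/(measurable_restrictT _ (measurableC mK)).
  exact: (measurable_funS measurableT).
Qed.

Lemma killed_ge0 n (f : T -> \bar R) : (forall x, (0 <= f x)%E) ->
  forall x, (0 <= killed n f x)%E.
Proof.
elim: n f => [//|n IHn] f f0 /=; apply: IHn; exact: killed_step_ge0.
Qed.

Lemma measurable_killed n (f : T -> \bar R) :
  (forall x, (0 <= f x)%E) -> measurable_fun setT f ->
  measurable_fun setT (killed n f).
Proof.
elim: n f => [//|n IHn] f f0 mf /=.
by apply: IHn; [exact: killed_step_ge0|exact: measurable_killed_step].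
Qed.

(** Induction on [n] peels off the last step, as the recursion of [killed] does, so [f] must stay
    general. The transition identity is required only on the excursion event; the lemma thus serves
    both [Z] from time 0 and an excursion of [X] that starts at time [m], with [A] recording the
    past. *)
Lemma integral_excursion (P : probability Omega R)
    (W : nat -> {mfun Omega >-> T}) (A : set Omega) m n (f : T -> \bar R) :
  measurable A -> (forall x, (0 <= f x)%E) -> measurable_fun setT f ->
  (forall j B, (j < n)%N -> measurable B ->
    P (A `&` away K W m (m + j) `&` W (m + j).+1 @^-1` B) =
    (\int[P]_(w in A `&` away K W m (m + j)) k j (W (m + j)%N w) B)%E) ->
  (\int[P]_(w in A `&` away K W m (m + n)) f (W (m + n)%N w) =
   \int[P]_(w in A `&` W m @^-1` (~` K)) killed n f (W m w))%E.
Proof.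
move=> mA; elim: n f => [|n IHn] f f0 mf Pk.
  by rewrite addn0 awaynn.
rewrite addnS awayS; last by rewrite leqW// leq_addr.
rewrite setIA (@integral_transition_in _ _ _ _ _ _ _ _
  (fun w => k n (W (m + n)%N w)))//.
- apply: (IHn (fun x => \int[k n x]_(y in ~` K) f y)%E).
  + exact: killed_step_ge0.
  + exact: measurable_killed_step.
  + by move=> j B jn; apply: Pk; rewrite ltnW.
- by apply: measurableI => //; exact: measurable_away.
- move=> B mB; apply: (measurableT_comp (measurable_kernel (k n) B mB)).
  exact: measurable_funP.
- by move=> B mB; apply: Pk.
- exact: measurableC.
Qed.

End killed.

(** * Integral bounds and the decreasing mean of a supermartingale *)

Lemma integral_ae_cst {d dT : measure_display} {Omega : measurableType d}
    {T : measurableType dT} {R : realType} (P : probability Omega R)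
    (W : {mfun Omega >-> T}) (x : T) (f : T -> \bar R) :
  {ae P, forall w, W w = x} ->
  (forall y, (0 <= f y)%E) -> measurable_fun setT f ->
  (\int[P]_w f (W w) = f x)%E.
Proof.
move=> Wx f0 mf; rewrite (@ge0_ae_eq_integral _ _ _ _ _ _ (cst (f x)))//.
- by rewrite integral_cst// [X in (_ * X)%E]probability_setT mule1.
- exact: measurableT_comp.
- by move=> w _; exact: f0.
- by apply: filterS Wx => w -> _.
Qed.

Lemma integral_le_bound {d : measure_display} {Omega : measurableType d}
    {R : realType} (P : probability Omega R) (A : set Omega)
    (f : Omega -> \bar R) (c : \bar R) :
  measurable A -> measurable_fun A f -> (forall w, A w -> (0 <= f w)%E) ->
  (0 <= c)%E -> (forall w, A w -> (f w <= c)%E) ->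
  (\int[P]_(w in A) f w <= c)%E.
Proof.
move=> mA mf f0 c0 fc; apply: (@le_trans _ _ (\int[P]_(w in A) cst c w)%E).
  exact: ge0_le_integral.
by rewrite integral_cst// -[leRHS]mule1 lee_wpmul2l// probability_le1.
Qed.

Lemma supermartingale_integral_le {d : measure_display}
    {Omega : measurableType d} {R : realType} (P : probability Omega R)
    (F : nat -> set (set Omega)) (M : nat -> Omega -> R) (t : nat) :
  (forall t, F t setT) -> (forall t w, 0 <= M t w) -> supermartingale P F M ->
  (\int[P]_w (M t w)%:E <= \int[P]_w (M 0%N w)%:E)%E.
Proof.
move=> FT M0 sM; elim: t => [//|t]; apply: le_trans.
have [_ /measurable_int mM [g [ig _ Pg] gM]] := sM t.
have mg := measurable_int _ ig.
(* Testing on the whole space replaces [M t.+1] by its version [g], whose sign is unknown. Its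
   positive part is still a.e. at most [M t], because [M t] is nonnegative. *)
rewrite -[leLHS](Pg _ (FT t)) integralE.
apply: (@le_trans _ _ (\int[P]_w g^\+ w)%E).
  by rewrite geeDl// oppe_le0 integral_ge0.
apply: ae_ge0_le_integral => //.
- exact: measurable_funepos.
- by move=> w _; rewrite lee_fin.
- by apply: filterS gM => w gMw _; rewrite funeposE ge_max gMw lee_fin M0.
Qed.

(** * Excursion starts and hitting times along a single path *)

Lemma excursion_startE {dT : measure_display} {T : measurableType dT}
    (K : set T) (x : nat -> T) m t :
  (m <= t)%N -> (forall i, (m <= i <= t)%N -> ~ K (x i)) ->
  (forall i, m = i.+1 -> K (x i)) -> excursion_start K x t = m.
Proof.
move=> mt out inK; rewrite /excursion_start; set a := fun s : nat => _.
have am : a m by exact/asboolP.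
have mi : m \in iota 0 t.+1 by rewrite mem_iota add0n ltnS.
have ha : has a (iota 0 t.+1) by apply/hasP; exists m.
have := nth_find 0 ha; have := ha; rewrite has_find size_iota => lt_find.
rewrite nth_iota// add0n => /asboolP outf.
(* The search cannot pass [m], which satisfies the predicate. If it stopped earlier, its window
   would contain [m - 1], where the path is in [K]. *)
apply/eqP; rewrite eqn_leq; apply/andP; split; rewrite leqNgt; apply/negP.
- by move=> /(before_find 0); rewrite nth_iota ?ltnS// add0n am.
- case: m inK {out am mi} mt => [//|m] inK mt; rewrite ltnS => fm.
  by apply: (outf m); [rewrite fm ltnW|exact: inK].
Qed.

Lemma min_hitting_time (T : Type) (K : set T) (x : nat -> T) n :
  (forall i, (i <= n)%N -> ~ K (x i)) -> min_time n (hitting_time K x) = n.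
Proof.
move=> out; rewrite /hitting_time; case: pselect => [ex|//] /=.
case: ex_minnP => m /andP[_ /set_mem Km] _; apply/minn_idPl.
by rewrite leqNgt; apply/negP => /ltnW /out.
Qed.

(** * Consequences of the Markov property for [Y] and [Z] *)

Section chains.
Context {dT : measure_display} {T : measurableType dT} {R : realType}.
Variables (K : set T) (mK : measurable K).

(** Passes from a realization of the chain to its kernel. It is applied to [Y], since [beta] is
    defined through the process while [X] shares only the kernel [kY]. *)
Lemma markov_chain_step {d : measure_display} {Omega : measurableType d}
    (k : nat -> R.-pker T ~> T) (P : T -> probability Omega R)
    (Z : nat -> {mfun Omega >-> T}) (z : T) (f : T -> \bar R) :
  markov_chain k P Z -> (forall x, (0 <= f x)%E) -> measurable_fun setT f ->
  (\int[P z]_w f (Z 1%N w) = \int[k 0%N z]_y f y)%E.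
Proof.
move=> mkZ f0 mf; have [Z0 Pk] := mkZ z.
rewrite (@integral_transition _ _ _ _ _ _ _ _ (fun w => k 0%N (Z 0%N w)))//.
- apply: (@integral_ae_cst _ _ _ _ _ _ (Z 0%N) _
    (fun x => \int[k 0%N x]_y f y)%E) => //.
  + by move=> x; exact: integral_ge0.
  + apply: measurable_fun_integral_kernel => // B mB.
    exact: measurable_kernel.
- move=> B mB; apply: (measurableT_comp (measurable_kernel (k 0%N) B mB)).
  exact: measurable_funP.
- move=> B mB; apply: cond_prob_integral (Pk 0%N B mB) _.
    exact: measurable_preimage.
  exact: natural_filtrationT.
Qed.

(** The left side is the mean of [phi (n, Z n)] while [Z] has not met [K]. There the stopped process
    has not been stopped, so its decreasing mean gives the bound. This turns hypothesis (i) into a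
    statement about kernels, which can be transferred to [X]. *)
Lemma killed_le_start {d : measure_display} {Omega : measurableType d}
    (k : nat -> R.-pker T ~> T) (P : T -> probability Omega R)
    (Z : nat -> {mfun Omega >-> T}) (z : T) (phi : nat * T -> R) n :
  markov_chain k P Z -> ~ K z ->
  measurable_fun setT phi -> (forall p, 0 <= phi p) ->
  (let M := fun (t : nat) (w : Omega) =>
     stopped_value K phi (fun s => Z s w) t in
   supermartingale (P z) (natural_filtration M) M) ->
  (killed K k n (fun x => (phi (n, x))%:E) z <= (phi (0%N, z))%:E)%E.
Proof.
move=> mkZ Kz mphi phi0 /=; set M := fun (t : nat) w => _ => sM.
have [Z0 Pk] := mkZ z.
have mphin i : measurable_fun setT (fun x => (phi (i, x))%:E).
  by apply/measurable_EFinP; apply: measurableT_comp.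
have ge0n i x : (0 <= (phi (i, x))%:E)%E by rewrite lee_fin.
have killed0 := killed_ge0 K k n (ge0n n).
have mM t : measurable_fun setT (EFin \o M t).
  by have [_ /measurable_int] := sM t.
have := @integral_excursion _ _ _ _ _ K k mK (P z) Z setT 0 n _ measurableT
  (ge0n n) (mphin n).
rewrite !setTI add0n => excursion.
(* As [Z 0 = z] a.s. and [z] is outside [K], restricting to [Z 0] outside [K] loses nothing. *)
have -> : killed K k n (fun x => (phi (n, x))%:E) z =
    (\int[P z]_(w in Z 0%N @^-1` (~` K))
       killed K k n (fun x => (phi (n, x))%:E) (Z 0%N w))%E.
  rewrite integral_mkcond (@integral_ae_cst _ _ _ _ _ _ (Z 0%N) z
    ((killed K k n (fun x => (phi (n, x))%:E)) \_ (~` K)))//.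
  - by rewrite patchE mem_set.
  - by move=> x; rewrite patchE; case: ifP.
  - apply/(measurable_restrictT _ (measurableC mK)).
    by apply: (measurable_funS measurableT) => //; exact: measurable_killed.
rewrite -excursion; last first.
  move=> j B _ mB; rewrite setTI add0n.
  apply: cond_prob_integral (Pk j B mB) _; first exact: measurable_preimage.
  exact: natural_filtration_away.
have mA := measurable_away Z 0 n mK.
rewrite (eq_integral (EFin \o M n)); last first.
  by move=> w /set_mem aw; rewrite /M /= /stopped_value min_hitting_time//.
(* Dropping the event only increases the integral, [phi] being nonnegative. *)
apply: (@le_trans _ _ (\int[P z]_w (M n w)%:E)%E).
  by apply: ge0_subset_integral => // w _; rewrite lee_fin phi0.
apply: le_trans (supermartingale_integral_le n _ _ sM) _.
- by move=> t; exact: natural_filtrationT.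
- by move=> t w; exact: phi0.
rewrite (eq_integral (fun w => (phi (0%N, Z 0%N w))%:E)); last first.
  move=> w _; rewrite /M /stopped_value /hitting_time.
  by case: pselect => // ?; rewrite /min_time min0n.
by rewrite (@integral_ae_cst _ _ _ _ _ _ (Z 0%N) z
  (fun x => (phi (0%N, x))%:E)).
Qed.

End chains.

(** * Entrances and excursions of the hybrid process *)

Lemma natural_filtration_mono {d dT : measure_display}
    {Omega : measurableType d} {T : measurableType dT}
    (W : nat -> Omega -> T) s t :
  (s <= t)%N -> natural_filtration W s `<=` natural_filtration W t.
Proof.
move=> st; apply: smallest_sub; first exact: smallest_sigma_algebra.
move=> B [i /= si WB]; apply: sub_gen_smallest.
by exists i => //=; exact: leq_trans si st.
Qed.

Section hybrid.
Context {d dT : measure_display} {Omega : measurableType d}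
  {T : measurableType dT} {R : realType}.
Variables (K : set T) (kY : R.-pker T ~> T) (kZ : nat -> R.-pker T ~> T).
Variables (P : probability Omega R) (X : nat -> {mfun Omega >-> T}).
Hypotheses (mK : measurable K) (hybridX : hybrid_process K kY kZ P X).

Lemma hybrid_step_in m (f : T -> \bar R) :
  (forall x, (0 <= f x)%E) -> measurable_fun setT f ->
  (\int[P]_(w in X m @^-1` K `&` X m.+1 @^-1` (~` K)) f (X m.+1 w) =
   \int[P]_(w in X m @^-1` K) \int[kY (X m w)]_(y in ~` K) f y)%E.
Proof.
move=> f0 mf; apply: integral_transition_in => //.
- exact: measurable_preimage.
- move=> B mB; apply: (measurableT_comp (measurable_kernel kY B mB)).
  exact: measurable_funP.
- move=> B mB; apply: eq_trans (cond_prob_integral _ (hybridX m mB) _) _.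
  + exact: measurable_preimage.
  + exact: natural_filtration_preimage.
  + by apply: eq_integral => w /set_mem Kw; rewrite /hybrid_transition mem_set.
- exact: measurableC.
Qed.

(* The condition on A says that either m = 0 or X (m - 1) is in K on A, so that
   an excursion in progress at time m starts exactly at time m. *)
Lemma hybrid_excursion m n (A : set Omega) (f : T -> \bar R) :
  natural_filtration X m A -> (forall w i, A w -> m = i.+1 -> K (X i w)) ->
  (forall x, (0 <= f x)%E) -> measurable_fun setT f ->
  (\int[P]_(w in A `&` away K X m (m + n)) f (X (m + n)%N w) =
   \int[P]_(w in A `&` X m @^-1` (~` K)) killed K kZ n f (X m w))%E.
Proof.
move=> FA AK f0 mf; apply: integral_excursion => //.
  exact: natural_filtration_sub FA.
move=> j B _ mB.
apply: eq_trans (cond_prob_integral _ (hybridX _ mB) _) _.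
- exact: measurable_preimage.
- apply: natural_filtrationI; last exact: natural_filtration_away.
  by apply: natural_filtration_mono FA; exact: leq_addr.
(* On this event the current excursion started at [m], so the clock of [Z] shows
   [(m + j) - m = j]. *)
- apply: eq_integral => w /set_mem[Aw aw].
  rewrite /hybrid_transition memNset; last by apply: aw; rewrite leq_addr leqnn.
  rewrite (@excursion_startE _ _ _ _ m) ?leq_addr ?addKn//.
  by move=> i; exact: AK.
Qed.

(** Here [n] is the age of the excursion: [V] is replaced by [theta * phi] at that age, then the
    excursion is folded back to its start. The bound on [killed] is needed only outside [K], where
    [X m] lies on the remaining event. *)
Lemma hybrid_excursion_le m n (A : set Omega) (phi : nat * T -> R)
    (V : T -> R) (theta : R) :
  natural_filtration X m A -> (forall w i, A w -> m = i.+1 -> K (X i w)) ->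
  measurable_fun setT phi -> (forall p, 0 <= phi p) ->
  measurable_fun setT V -> (forall x, 0 <= V x) -> 0 < theta ->
  (forall x, V x / theta <= phi (n, x)) ->
  (forall z, ~ K z ->
    (killed K kZ n (fun x => (phi (n, x))%:E) z <= (phi (0%N, z))%:E)%E) ->
  (\int[P]_(w in A `&` away K X m (m + n)) (V (X (m + n)%N w))%:E <=
   theta%:E *
     \int[P]_(w in A `&` X m @^-1` (~` K)) (phi (0%N, X m w))%:E)%E.
Proof.
move=> FA AK mphi phi0 mV V0 theta0 Vphi kphi.
have mA := natural_filtration_sub FA.
have mphin i : measurable_fun setT (fun x => (phi (i, x))%:E).
  by apply/measurable_EFinP; apply: measurableT_comp.
have mphiX i j D : measurable_fun D (fun w => (phi (i, X j w))%:E).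
  apply: (measurable_funS measurableT) => //.
  exact: (measurableT_comp (mphin i)).
have ge0n i x : (0 <= (phi (i, x))%:E)%E by rewrite lee_fin.
have mD : measurable (A `&` away K X m (m + n)).
  by apply: measurableI => //; exact: measurable_away.
have mD0 : measurable (A `&` X m @^-1` (~` K)).
  by apply: measurableI => //; apply: measurable_preimage; exact: measurableC.
apply: (@le_trans _ _ (\int[P]_(w in A `&` away K X m (m + n))
    (theta%:E * (phi (n, X (m + n)%N w))%:E))%E).
  apply: ge0_le_integral => //.
  - by move=> w _; rewrite lee_fin.
  - apply: (measurable_funS measurableT) => //; apply/measurable_EFinP.
    exact: (measurableT_comp mV).
  - exact: measurable_funeM.
  - by move=> w _; rewrite -EFinM lee_fin mulrC -ler_pdivrMr.
rewrite ge0_integralZl//; last by rewrite lee_fin ltW.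
rewrite lee_wpmul2l ?lee_fin ?(ltW theta0)//.
rewrite (hybrid_excursion n FA AK (ge0n n) (mphin n)).
apply: ge0_le_integral => //.
- by move=> w _; exact: killed_ge0.
- apply: (measurable_funS measurableT) => //.
  apply: (measurableT_comp _ (measurable_funP (X m))).
  exact: measurable_killed.
- by move=> w [_]; exact: kphi.
Qed.

End hybrid.

(** * Summing the excursion bounds over the last visit to [K] *)

Theorem theorem2p9 (R : realType) (S : ptopologicalType)
  (polishS : polish_space R S)
  (K : set (borel S)) (mK : measurable K)
  (dY : measure_display) (OmegaY : measurableType dY)
  (kY : R.-pker (borel S) ~> (borel S))
  (PY : borel S -> probability OmegaY R)
  (Y : nat -> {mfun OmegaY >-> borel S})
  (markovY : markov_chain (fun=> kY) PY Y)
  (dZ : measure_display) (OmegaZ : measurableType dZ)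
  (kZ : nat -> R.-pker (borel S) ~> (borel S))
  (PZ : borel S -> probability OmegaZ R)
  (Z : nat -> {mfun OmegaZ >-> borel S})
  (markovZ : markov_chain kZ PZ Z)
  (d : measure_display) (Omega : measurableType d) (P : probability Omega R)
  (X : nat -> {mfun Omega >-> borel S})
  (hybridX : hybrid_process K kY kZ P X)
  (phi : nat * borel S -> R)
  (mphi : measurable_fun [set: nat * borel S] phi)
  (phi_ge0 : forall p, 0 <= phi p)
  (V : borel S -> R) (mV : measurable_fun [set: borel S] V)
  (V_ge0 : forall x, 0 <= V x)
  (theta : nat -> R) (theta_gt0 : forall t, 0 < theta t)
  (supermart : forall z0, ~ K z0 ->
     let M := fun (t : nat) (w : OmegaZ) =>
       stopped_value K phi (fun s => Z s w) t in
     supermartingale (PZ z0) (natural_filtration M) M)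
  (phi_ge : forall t x, V x / theta t <= phi (t, x))
  (x0 : borel S) (x0K : ~ K x0) (startX : {ae P, forall w, X 0%N w = x0}) :
  let C : \bar R := (\sum_(0 <= t <oo) (theta t)%:E)%E in
  let delta : \bar R := nneg_sup [set (V x)%:E | x in K] in
  let beta : \bar R := nneg_sup
    [set 'E_(PY y0)[fun w => (phi (0%N, Y 1%N w) * \1_(~` K) (Y 1%N w))%R]%E
    | y0 in K] in
  let gamma : \bar R := ereal_sup [set (theta t)%:E | t in [set: nat]] in
  (C < +oo)%E -> (delta < +oo)%E -> (beta < +oo)%E ->
  (ereal_sup [set 'E_P[fun w => V (X t w)]%E | t in [set: nat]]
   <= C * beta + delta + gamma * (phi (0%N, x0))%:E)%E.
Proof.
move=> C delta beta gamma Cfin deltafin betafin.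
have mphin i : measurable_fun setT (fun x => (phi (i, x))%:E).
  by apply/measurable_EFinP; apply: measurableT_comp.
have ge0n i x : (0 <= (phi (i, x))%:E)%E by rewrite lee_fin.
(* The 0 adjoined by [nneg_sup] makes this true even for empty [K]. *)
have beta0 : (0 <= beta)%E by apply: ereal_sup_ubound; left.
have delta0 : (0 <= delta)%E by apply: ereal_sup_ubound; left.
have mKc : measurable (~` K) by exact: measurableC.
have kphi n z : ~ K z ->
    (killed K kZ n (fun x => (phi (n, x))%:E) z <= (phi (0%N, z))%:E)%E.
  by move=> Kz; apply: (killed_le_start mK n markovZ) => //; exact: supermart.
have kYbeta y : K y -> (\int[kY y]_(x in ~` K) (phi (0%N, x))%:E <= beta)%E.
  move=> Ky; apply: ereal_sup_ubound; right; exists y => //.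
  rewrite unlock [RHS]integral_mkcond.
  rewrite -(markov_chain_step y markovY).
  - apply: eq_integral => w _; rewrite patchE indicE.
    by case: (Y 1%N w \in ~` K); rewrite ?mulr1 ?mulr0.
  - by move=> x; rewrite patchE; case: ifP => // _; exact: ge0n.
  - apply/(measurable_restrictT _ mKc).
    by apply: (measurable_funS measurableT) => //; exact: mphin.
have mVX t D : measurable_fun D (fun w => (V (X t w))%:E).
  apply: (measurable_funS measurableT) => //; apply/measurable_EFinP.
  exact: (measurableT_comp mV).
have Vphi n x : V x / theta n <= phi (n, x) by exact: phi_ge.
(* The term in [theta t] is for paths that have never met [K]; the summand [s] is for a last visit
   at time [s], whose excursion has age [t - s.+1] at time [t]. *)
have bound t r : (r <= t)%N ->
    (\int[P]_(w in away K X r t) (V (X t w))%:E <=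
     (theta t * phi (0%N, x0))%:E +
     (\sum_(s < r) theta (t - s.+1)%N)%:E * beta)%E.
  elim: r => [_|r IHr rt].
    have FT : natural_filtration X 0 setT by exact: natural_filtrationT.
    have := hybrid_excursion_le (A := setT) (m := 0%N) (n := t) mK hybridX
      FT _ mphi phi_ge0 mV V_ge0 (theta_gt0 t) (Vphi t)
      (kphi t).
    rewrite !setTI add0n big_ord0 mul0e adde0.
    move=> /(_ ltac:(by [])) /le_trans; apply.
    rewrite EFinM lee_wpmul2l ?lee_fin ?(ltW (theta_gt0 t))//.
    rewrite -(integral_ae_cst startX (ge0n 0%N) (mphin 0%N)).
    apply: ge0_subset_integral => //; first exact: measurable_preimage.
    exact: (measurableT_comp (mphin 0%N)).
  (* A path avoiding [K] from [r.+1] to [t] either avoids it at [r] too, which is the induction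
     hypothesis, or has its last visit at [r]. *)
  have -> : away K X r.+1 t =
      away K X r t `|` (X r @^-1` K `&` away K X r.+1 t).
    rewrite (away_split _ _ (ltnW rt)) setUC -setIUl -preimage_setU.
    by rewrite setUv preimage_setT setTI.
  rewrite ge0_integral_setU//; last 4 first.
  - exact: measurable_away.
  - by apply: measurableI; [exact: measurable_preimage|exact: measurable_away].
  - by move=> w _; rewrite lee_fin.
  - rewrite (away_split _ _ (ltnW rt)); apply/disj_setPS => w [[nK _] [Kw _]].
    exact: nK.
  rewrite big_ord_recr/= EFinD ge0_muleDl ?lee_fin; last 2 first.
  - by apply: sumr_ge0 => s _; exact: ltW.
  - exact: ltW.
  rewrite [leRHS]addeA; apply: leeD; first by apply: IHr; exact: ltnW.
  have FK : natural_filtration X r.+1 (X r @^-1` K).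
    exact: natural_filtration_preimage.
  have XrK w i : (X r @^-1` K) w -> r.+1 = i.+1 -> K (X i w) by move=> + [<-].
  have := hybrid_excursion_le (A := X r @^-1` K) (m := r.+1)
      (n := (t - r.+1)%N) mK hybridX
      FK XrK mphi phi_ge0 mV V_ge0
      (theta_gt0 _) (Vphi _) (kphi _).
  rewrite subnKC// => /le_trans; apply.
  rewrite lee_wpmul2l ?lee_fin ?(ltW (theta_gt0 _))//.
  (* The excursion is entered by a step of [kY] from [X r] in [K], so the integrand is at most
     [beta], on an event of probability at most 1. *)
  rewrite (hybrid_step_in mK hybridX r (ge0n 0%N) (mphin 0%N)).
  apply: integral_le_bound => //.
  - exact: measurable_preimage.
  - apply: (measurable_funS measurableT) => //.
    apply: (measurableT_comp
      (f := fun x => \int[kY x]_(y in ~` K) (phi (0%N, y))%:E)%E) => //.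
    exact: (measurable_killed_step (fun=> kY) mK 0).
  - by move=> w _; exact: integral_ge0.
  - by move=> w; exact: kYbeta.
apply: ge_ereal_sup => _ [t _ <-]; rewrite unlock.
(* The first piece costs at most [delta]; the second is [bound] with [r = t]. *)
rewrite (_ : [set: Omega] = X t @^-1` K `|` away K X t t); last first.
  by rewrite awaynn -preimage_setU setUv preimage_setT.
rewrite ge0_integral_setU//; last 4 first.
- exact: measurable_preimage.
- exact: measurable_away.
- by move=> w _; rewrite lee_fin.
- by rewrite awaynn; apply/disj_setPS => w [Kw]; exact.
have -> : (C * beta + delta + gamma * (phi (0%N, x0))%:E =
    delta + (gamma * (phi (0%N, x0))%:E + C * beta))%E.
  by rewrite (addeC (C * beta)%E) -addeA (addeC (C * beta)%E).
apply: leeD.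
  apply: integral_le_bound => //.
  - exact: measurable_preimage.
  - by move=> w _; rewrite lee_fin.
  - by move=> w Kw; apply: ereal_sup_ubound; right; exists (X t w).
apply: le_trans (bound t t (leqnn t)) _; apply: leeD.
  rewrite EFinM lee_wpmul2r ?lee_fin//.
  by apply: ereal_sup_ubound; exists t.
rewrite lee_wpmul2r//.
(* Reversing the order turns the sum over ages into a partial sum of the nonnegative series [C]. *)
have -> : \sum_(s < t) theta (t - s.+1)%N = \sum_(0 <= s < t) theta s.
  by rewrite big_nat_rev big_mkord; apply: eq_bigr => s _; rewrite add0n.
rewrite -sumEFin; apply: nneseries_lim_ge => s _ _.
by rewrite lee_fin ltW.
Qed.
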